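(* Let $p\ge2$ be an integer, $F=(F[0],\dots,F[p-1])$ a closed $p$-fibred function, and $k\ge1$ an integer. Then: (1) If $F[r]$ is weakly $(p,r)$-suitable at $\{0,\dots,k\}$ for every $r\in\{0,\dots,p-1\}$, then $F$ has the weak block property at $\{0,\dots,k\}$. In particular, if $F[r]$ is weakly $(p,r)$-suitable for every $r\in\{0,\dots,p-1\}$, then $F$ has the weak block property. (2) $F[r]$ is $(p,r)$-suitable at $\{0,\dots,k\}$ for every $r\in\{0,\dots,p-1\}$ if and only if $F$ has the block property at $\{0,\dots,k\}$. In particular, $F[r]$ is $(p,r)$-suitable for every $r\in\{0,\dots,p-1\}$ if and only if $F$ has the block property.
   Context: $p\ge2$ is an integer, not necessarily prime. $\mathbb{Z}_p=\varprojlim \mathbb{Z}/p^k\mathbb{Z}$; every $a\in\mathbb{Z}_p$ is uniquely $a=\sum_{i\ge0}a_ip^i$ with $a_i\in\{0,\dots,p-1\}$, and $a\,\%\,p:=a_0$. A $p$-fibred function with domain $A\subseteq\mathbb{Z}_p$ is a $p$-tuple $F=(F[0],\dots,F[p-1])$ of functions $F[r]:A\to\mathbb{Z}_p$, regarded also as a function $F:A\to\mathbb{Z}_p$ by $F(n)=\dfrac{F[n\%p](n)-(F[n\%p](n)\,\%\,p)}{p}$. It is closed if $F(A)\subseteq A$. For closed $F$, the $F$-digit expansion of $n\in A$ is the sequence $(F^k(n)\,\%\,p)_{k\ge0}$. For $K\subseteq\mathbb{N}_0=\{0,1,2,\dots\}$, a closed $F$ has the weak block property at $K$ if for all $k\in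 K$ and $m,n\in A$: $m\equiv n\pmod{p^k}$ implies that the first $k$ entries of the $F$-digit expansions of $m$ and $n$ coincide; it has the block property at $K$ if this implication is an equivalence for all $k\in K$ and $m,n\in A$. ''Weak block property'' and ''block property'' without specification mean $K=\mathbb{N}_0$. For $r\in\{0,\dots,p-1\}$, a function $f:A\to\mathbb{Z}_p$ is weakly $(p,r)$-suitable at $K$ if for all $k\in K$ and all $m,n\in(r+p\mathbb{Z}_p)\cap A$: $m\equiv n\pmod{p^k}$ implies $f(m)-(f(m)\%p)\equiv f(n)-(f(n)\%p)\pmod{p^k}$; it is $(p,r)$-suitable at $K$ if this implication is an equivalence for all such $k,m,n$. Without specification, $K=\mathbb{N}_0$. *)

(* Defs.v *)
From HB Require Import structures.
From mathcomp Require Import all_boot all_order all_algebra.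
From mathcomp Require Import boolp classical_sets.
From mathcomp Require Import ring.

Set Implicit Arguments.
Unset Strict Implicit.
Unset Printing Implicit Defensive.

Import GRing.Theory.

Local Open Scope classical_set_scope.
Local Open Scope ring_scope.

(* The ring of p-adic integers for p >= 2 not necessarily prime: the inverse  *)
(* limit of the rings Z/p^kZ along the reduction maps.  The image of x in     *)
(* Z/p^kZ is given by its representative residue x k in {0, ..., p^k - 1}.    *)
(* The hypothesis 2 <= p is a parameter of the type, so that the ring         *)
(* structure can be inferred from it (Z_0 and Z_1 are never formed).          *)
Record padic_int (p : nat) (hp : (2 <= p)%N) := PadicInt {
  residue : nat -> nat;
  residue_lt : forall k, (residue k < p ^ k)%N;
  residue_compat : forall k, (residue k.+1 %% p ^ k)%N = residue k }.

HB.instance Definition _ p (hp : (2 <= p)%N) := gen_eqMixin (padic_int hp).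
HB.instance Definition _ p (hp : (2 <= p)%N) := gen_choiceMixin (padic_int hp).

Section PadicRing.
Variables (p : nat) (hp : (2 <= p)%N).
Local Notation Zp := (padic_int hp).
Implicit Types x y z : Zp.

Lemma padic_eqP x y : residue x =1 residue y -> x = y.
Proof.
case: x y => [u u1 u2] [v v1 v2] /= /funext uv; subst v.
by congr PadicInt; apply: Prop_irrelevance.
Qed.

Lemma expp_gt0 k : (0 < p ^ k)%N.
Proof. by rewrite expn_gt0 (leq_trans _ hp). Qed.

Lemma residue_mod x k : (residue x k %% p ^ k)%N = residue x k.
Proof. by rewrite modn_small ?residue_lt. Qed.

Section OfSeq.
Variables (u : nat -> nat) (hu : forall k, u k.+1 = u k %[mod p ^ k]).

Lemma of_seq_lt k : (u k %% p ^ k < p ^ k)%N.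
Proof. by rewrite ltn_mod expp_gt0. Qed.

Lemma of_seq_compat k : ((u k.+1 %% p ^ k.+1) %% p ^ k)%N = (u k %% p ^ k)%N.
Proof. by rewrite modn_dvdm ?dvdn_exp2l. Qed.

Definition padic_of_seq : Zp := PadicInt hp of_seq_lt of_seq_compat.
End OfSeq.

Fact add_compat x y k :
  (residue x k.+1 + residue y k.+1 = residue x k + residue y k %[mod p ^ k])%N.
Proof. by rewrite -modnDm !residue_compat. Qed.

Fact mul_compat x y k :
  (residue x k.+1 * residue y k.+1 = residue x k * residue y k %[mod p ^ k])%N.
Proof. by rewrite -modnMm !residue_compat. Qed.

Fact opp_compat x k :
  (p ^ k.+1 - residue x k.+1 = p ^ k - residue x k %[mod p ^ k])%N.
Proof.
apply/eqP; rewrite -(eqn_modDr (residue x k.+1)) subnK ?(ltnW (residue_lt _ _))//.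
rewrite -[X in _ == X]modnDmr residue_compat.
by rewrite subnK ?(ltnW (residue_lt _ _))// modnn expnS modnMl.
Qed.

Fact nat_compat (c : nat) k : c = c %[mod p ^ k]. Proof. by []. Qed.

Definition padic_nat (c : nat) : Zp := @padic_of_seq (fun=> c) (nat_compat c).
Definition padic_add x y := padic_of_seq (add_compat x y).
Definition padic_mul x y := padic_of_seq (mul_compat x y).
Definition padic_opp x := padic_of_seq (opp_compat x).

Fact padic_addA : associative padic_add.
Proof. by move=> x y z; apply: padic_eqP => k /=; rewrite modnDml modnDmr addnA. Qed.

Fact padic_addC : commutative padic_add.
Proof. by move=> x y; apply: padic_eqP => k /=; rewrite addnC. Qed.

Fact padic_add0 : left_id (padic_nat 0) padic_add.
Proof. by move=> x; apply: padic_eqP => k /=; rewrite mod0n add0n residue_mod. Qed.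

Fact padic_addN : left_inverse (padic_nat 0) padic_opp padic_add.
Proof.
move=> x; apply: padic_eqP => k /=.
by rewrite modnDml subnK ?(ltnW (residue_lt _ _))// modnn mod0n.
Qed.

Fact padic_mulA : associative padic_mul.
Proof. by move=> x y z; apply: padic_eqP => k /=; rewrite modnMml modnMmr mulnA. Qed.

Fact padic_mulC : commutative padic_mul.
Proof. by move=> x y; apply: padic_eqP => k /=; rewrite mulnC. Qed.

Fact padic_mul1 : left_id (padic_nat 1) padic_mul.
Proof. by move=> x; apply: padic_eqP => k /=; rewrite modnMml mul1n residue_mod. Qed.

Fact padic_mulDl : left_distributive padic_mul padic_add.
Proof.
by move=> x y z; apply: padic_eqP => k /=; rewrite modnMml modnDm mulnDl.
Qed.

Fact padic_1neq0 : padic_nat 1 != padic_nat 0.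
Proof.
apply/eqP => /(congr1 (fun x => residue x 1)) /=.
by rewrite expn1 mod0n modn_small.
Qed.

HB.instance Definition _ := GRing.isZmodule.Build (padic_int hp)
  padic_addA padic_addC padic_add0 padic_addN.
HB.instance Definition _ := GRing.Zmodule_isComNzRing.Build (padic_int hp)
  padic_mulA padic_mulC padic_mul1 padic_mulDl padic_1neq0.

Lemma residueD x y k : residue (x + y) k = ((residue x k + residue y k) %% p ^ k)%N.
Proof. by []. Qed.

Lemma residueM x y k : residue (x * y) k = ((residue x k * residue y k) %% p ^ k)%N.
Proof. by []. Qed.

Lemma residue_nat (c k : nat) : residue (c%:R : Zp) k = (c %% p ^ k)%N.
Proof.
elim: c => [//|c IHc].
by rewrite -natr1 residueD IHc modnDm addn1.
Qed.

Fact digit_lt x i : (residue x i.+1 %/ p ^ i < p)%N.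
Proof. by rewrite ltn_divLR ?expp_gt0// -expnS residue_lt. Qed.

(* The digit a_i of a = \sum_i a_i p^i; see residue_digits. *)
Definition digit x (i : nat) : 'I_p := Ordinal (digit_lt x i).

Lemma residue_digits x k : residue x k = (\sum_(i < k) digit x i * p ^ i)%N.
Proof.
elim: k => [|k IHk]; first by rewrite big_ord0; case: (residue x 0) (residue_lt x 0).
by rewrite big_ord_recr /= -IHk -(residue_compat x k) addnC -divn_eq.
Qed.

(* a % p *)
Definition padic_mod x : 'I_p := digit x 0.

Lemma padic_modE x : padic_mod x = residue x 1 :> nat.
Proof. by rewrite residue_digits big_ord1 muln1. Qed.

Lemma padic_div_lt x k : (residue x k.+1 %/ p < p ^ k)%N.
Proof. by rewrite ltn_divLR ?(leq_trans _ hp)// mulnC -expnS residue_lt. Qed.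

Lemma padic_div_compat x k : ((residue x k.+2 %/ p) %% p ^ k)%N = (residue x k.+1 %/ p)%N.
Proof. by rewrite modn_divl mulnC -expnS residue_compat. Qed.

(* Exact division by p on p Z_p; see mulp_padic_div and mulpI. *)
Definition padic_div x : Zp := PadicInt hp (padic_div_lt x) (padic_div_compat x).

Lemma residue_mulp x k : residue (p%:R * x) k.+1 = (p * residue x k)%N.
Proof.
rewrite residueM residue_nat modnMml expnS -muln_modr.
by rewrite -[in RHS](residue_compat x k).
Qed.

Lemma mulp_padic_div x : padic_mod x = 0%N :> nat -> p%:R * padic_div x = x.
Proof.
rewrite padic_modE => x0; apply: padic_eqP => -[|k].
  by case: (residue x 0) (residue_lt x 0) (residue (p%:R * padic_div x) 0)
    (residue_lt (p%:R * padic_div x) 0) => // _ [].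
rewrite residue_mulp /= mulnC divnK //.
elim: k => [|k IHk]; first by rewrite x0.
have := IHk; rewrite -residue_compat expnS /dvdn modn_dvdm // dvdn_mulr //.
Qed.

Lemma mulpI : injective (fun x : Zp => p%:R * x).
Proof.
move=> x y /= xy; apply: padic_eqP => k; apply/eqP.
by rewrite -(eqn_pmul2l (leq_trans _ hp : 0 < p)%N) // -!residue_mulp xy.
Qed.

(* x = y mod p^k, i.e. x - y \in p^k Z_p *)
Definition padic_congr (k : nat) x y := exists z : Zp, x - y = p%:R ^+ k * z.

Definition residue_class (r : 'I_p) : set Zp :=
  [set x | exists z : Zp, x = (r : nat)%:R + p%:R * z].

Definition sub_padic_mod x : Zp := x - (padic_mod x : nat)%:R.

Lemma padic_congrP k x y : padic_congr k x y <-> residue x k = residue y k.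
Proof.
have shift j : forall z : Zp, residue z j = 0%N -> exists t, z = p%:R ^+ j * t.
  elim: j => [|j IHj] z zj; first by exists z; rewrite expr0 mul1r.
  have z1 : padic_mod z = 0%N :> nat.
    elim: j zj {IHj} => [|j IHj] zj; first by rewrite padic_modE.
    by apply: IHj; rewrite -residue_compat zj mod0n.
  have [t zt] : exists t, padic_div z = p%:R ^+ j * t.
    by apply: IHj; rewrite /= zj div0n.
  by exists t; rewrite -(mulp_padic_div z1) zt mulrA exprS.
have low j (z : Zp) : residue (p%:R ^+ j * z) j = 0%N.
  elim: j => [|j IHj]; last by rewrite exprS -mulrA residue_mulp IHj muln0.
  by case: (residue _ 0) (residue_lt (p%:R ^+ 0 * z) 0).
split=> [[z xyz]|xy].
  have -> : x = y + p%:R ^+ k * z by rewrite -xyz addrC subrK.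
  by rewrite residueD low addn0 residue_mod.
apply: shift; rewrite residueD xy -residueD subrr.
by rewrite -[0]/(0%:R : Zp) residue_nat mod0n.
Qed.

Lemma residue_classP (r : 'I_p) x : residue_class r x <-> padic_mod x = r.
Proof.
have rr : residue ((r : nat)%:R : Zp) 1 = r.
  by rewrite residue_nat expn1 modn_small.
have -> : residue_class r x <-> padic_congr 1 x (r : nat)%:R.
  rewrite /residue_class /padic_congr /= expr1; split=> -[z xz]; exists z.
    by rewrite xz addrC addKr.
  by rewrite -xz addrC subrK.
by rewrite padic_congrP rr -padic_modE; split=> [/val_inj|->].
Qed.

Lemma mulp_padic_div_sub x : p%:R * padic_div (sub_padic_mod x) = sub_padic_mod x.
Proof.
apply: mulp_padic_div; rewrite padic_modE.
have : padic_congr 1 x (padic_mod x : nat)%:R.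
  by apply/padic_congrP; rewrite residue_nat expn1 modn_small ?padic_modE// -padic_modE.
case=> z; rewrite -/(sub_padic_mod x) expr1 => ->.
have := residue_mulp z 0; case: (residue z 0) (residue_lt z 0) => // _ ->.
by rewrite muln0.
Qed.

End PadicRing.

Section Fibred.
Variables (p : nat) (hp : (2 <= p)%N) (A : set (padic_int hp)).

Definition fibred_function := 'I_p -> A -> padic_int hp.

(* F regarded as a function A -> Z_p *)
Definition fibred_map (F : fibred_function) (n : A) : padic_int hp :=
  padic_div (sub_padic_mod (F (padic_mod (val n)) n)).

Definition fibred_closed (F : fibred_function) := forall n : A, A (fibred_map F n).

Definition closed_map (F : fibred_function) (hF : fibred_closed F) (n : A) : A :=
  exist _ (fibred_map F n) (mem_set (hF n)).

Definition digit_expansion (F : fibred_function) (hF : fibred_closed F)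
    (n : A) (k : nat) : 'I_p :=
  padic_mod (val (iter k (closed_map hF) n)).

Definition weak_block_property_at (K : set nat) (F : fibred_function)
    (hF : fibred_closed F) :=
  forall k, K k -> forall m n : A,
    padic_congr k (val m) (val n) ->
    (forall i, (i < k)%N -> digit_expansion hF m i = digit_expansion hF n i).

Definition block_property_at (K : set nat) (F : fibred_function)
    (hF : fibred_closed F) :=
  forall k, K k -> forall m n : A,
    padic_congr k (val m) (val n) <->
    (forall i, (i < k)%N -> digit_expansion hF m i = digit_expansion hF n i).

Definition weak_block_property (F : fibred_function) (hF : fibred_closed F) :=
  weak_block_property_at setT hF.

Definition block_property (F : fibred_function) (hF : fibred_closed F) :=
  block_property_at setT hF.

Definition weakly_suitable_at (K : set nat) (r : 'I_p) (f : A -> padic_int hp) :=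
  forall k, K k -> forall m n : A,
    residue_class r (val m) -> residue_class r (val n) ->
    padic_congr k (val m) (val n) -> padic_congr k (sub_padic_mod (f m)) (sub_padic_mod (f n)).

Definition suitable_at (K : set nat) (r : 'I_p) (f : A -> padic_int hp) :=
  forall k, K k -> forall m n : A,
    residue_class r (val m) -> residue_class r (val n) ->
    (padic_congr k (val m) (val n) <-> padic_congr k (sub_padic_mod (f m)) (sub_padic_mod (f n))).

Definition weakly_suitable (r : 'I_p) (f : A -> padic_int hp) :=
  weakly_suitable_at setT r f.

Definition suitable (r : 'I_p) (f : A -> padic_int hp) := suitable_at setT r f.

End Fibred.

(* Main.v *)
(* Let D_j(m, n) say that the first j digits of the F-expansions of m and n    *)
(* agree.  Then D_(j+1)(m, n) holds iff m = n mod p and D_j(F m, F n), while   *)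
(* for m = n = r mod p the congruence F m = F n mod p^j is equivalent to       *)
(* F[r](m) - F[r](m) % p = F[r](n) - F[r](n) % p mod p^(j+1).  So suitability  *)
(* at j+1 is exactly the induction step from the block property at j to the    *)
(* block property at j+1, and everything works on any set K closed under       *)
(* predecessor, in particular {0, ..., k} and the set of all naturals.         *)
Require Import Defs.
From mathcomp Require Import all_boot all_order all_algebra.
From mathcomp Require Import boolp classical_sets.

Local Open Scope classical_set_scope.

(** The two equivalences behind the induction step are [digit_expansionS] for digits and
    [fibred_map_congr] for congruences. From suitability to blocks one inducts on the level; the
    converse only compares two consecutive levels. *)

Lemma padic_congr0 {p : nat} {hp : (2 <= p)%N} (x y : padic_int hp) :
  padic_congr 0 x y.
Proof.
apply/padic_congrP.
by case: (residue x 0) (residue_lt x 0) (residue y 0) (residue_lt y 0)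
  => // _ [].
Qed.

Lemma padic_congrS_mod {p : nat} {hp : (2 <= p)%N} {j : nat}
    {x y : padic_int hp} :
  padic_congr j.+1 x y -> padic_mod x = padic_mod y.
Proof.
move=> /padic_congrP; elim: j => [|j IHj] xy.
  by apply/ord_inj; rewrite !padic_modE.
by apply: IHj; rewrite -residue_compat xy residue_compat.
Qed.

(** Multiplying by [p] shifts residues up one level and scales them by [p], a factor that
    cancels. *)
Lemma padic_congr_div_sub {p : nat} {hp : (2 <= p)%N} {j : nat}
    {x y : padic_int hp} :
  padic_congr j (padic_div (sub_padic_mod x)) (padic_div (sub_padic_mod y)) <->
  padic_congr j.+1 (sub_padic_mod x) (sub_padic_mod y).
Proof.
rewrite !padic_congrP -[in X in _ <-> X](mulp_padic_div_sub x).
rewrite -[in X in _ <-> X](mulp_padic_div_sub y) !residue_mulp.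
split=> [->//|/eqP]; rewrite eqn_pmul2l ?(leq_trans _ hp)//.
by move/eqP.
Qed.

Section Blocks.
Context {p : nat} {hp : (2 <= p)%N} {A : set (padic_int hp)}.
Context {F : fibred_function A} (hF : fibred_closed F).

Lemma fibred_map_congr {r : 'I_p} {j : nat} {m n : A} :
  padic_mod (val m) = r -> padic_mod (val n) = r ->
  padic_congr j (val (closed_map hF m)) (val (closed_map hF n)) <->
  padic_congr j.+1 (sub_padic_mod (F r m)) (sub_padic_mod (F r n)).
Proof.
by move=> mr nr; rewrite -padic_congr_div_sub /= /fibred_map mr nr.
Qed.

Lemma digit_expansionS {j : nat} {m n : A} :
  (forall i, (i < j.+1)%N -> digit_expansion hF m i = digit_expansion hF n i)
  <-> padic_mod (val m) = padic_mod (val n) /\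
  (forall i, (i < j)%N -> digit_expansion hF (closed_map hF m) i =
                          digit_expansion hF (closed_map hF n) i).
Proof.
split=> [mn|[mn0 mn] [|i] ij].
- split=> [|i ij]; first exact: mn 0 isT.
  by move: (mn i.+1 ij); rewrite /digit_expansion !iterSr.
- exact: mn0.
- by move: (mn i ij); rewrite /digit_expansion !iterSr.
Qed.

Context {K : set nat} (hK : forall j, K j.+1 -> K j).

Lemma weakly_suitable_weak_block :
  (forall r, weakly_suitable_at K r (F r)) -> weak_block_property_at K hF.
Proof.
move=> suitF; elim=> [//|j IHj] Kj m n mn.
(* A common last digit means that the same [F r] acts on [m] and [n]. *)
have mn0 := padic_congrS_mod mn.
apply/digit_expansionS; split=> //; apply: IHj; first exact: hK.
apply/(fibred_map_congr mn0 erefl).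
by apply: suitF => //; apply/residue_classP.
Qed.

Lemma suitable_block :
  (forall r, suitable_at K r (F r)) -> block_property_at K hF.
Proof.
move=> suitF j Kj m n; split.
  apply: weakly_suitable_weak_block Kj _ _ => r i Ki x y xr yr.
  by case: (suitF r i Ki x y xr yr).
elim: j Kj m n => [|j IHj] Kj m n; first by move=> _; exact: padic_congr0.
move=> /digit_expansionS[mn0 mn].
(* Here suitability is used backwards, to lift a congruence of values to one of [m] and [n]. *)
apply/(suitF (padic_mod (val n)) _ Kj); [exact/residue_classP..|].
by apply/fibred_map_congr => //; apply: IHj => //; exact: hK.
Qed.

(** On a residue class, both sides of suitability at [j.+1] translate, by the block property at
    [j.+1] and at [j], into agreement of the first [j] digits after one application of [F]. *)
Lemma block_suitable :
  block_property_at K hF -> forall r, suitable_at K r (F r).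
Proof.
move=> blockF r [|j] Kj m n /residue_classP mr /residue_classP nr.
  by split=> _; exact: padic_congr0.
rewrite -(fibred_map_congr mr nr) (blockF _ Kj) (blockF _ (hK _ Kj)).
by rewrite digit_expansionS mr nr; split=> [[]|].
Qed.

End Blocks.

Theorem theorem4p1 (p : nat) (hp : (2 <= p)%N) (A : set (padic_int hp))
    (F : fibred_function A) (hF : fibred_closed F) (k : nat) (hk : (1 <= k)%N) :
  (((forall r : 'I_p, weakly_suitable_at [set j : nat | (j <= k)%N] r (F r)) ->
      weak_block_property_at [set j : nat | (j <= k)%N] hF) /\
   ((forall r : 'I_p, weakly_suitable r (F r)) -> weak_block_property hF)) /\
  (((forall r : 'I_p, suitable_at [set j : nat | (j <= k)%N] r (F r)) <->
      block_property_at [set j : nat | (j <= k)%N] hF) /\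
   ((forall r : 'I_p, suitable r (F r)) <-> block_property hF)).
Proof.
have hk_pred (j : nat) : [set j | (j <= k)%N] j.+1 -> [set j | (j <= k)%N] j.
  exact: ltnW.
have hT_pred (j : nat) : [set: nat] j.+1 -> [set: nat] j by [].
split; split.
- exact: weakly_suitable_weak_block hk_pred.
- exact: weakly_suitable_weak_block hT_pred.
- by split; [exact: suitable_block hk_pred | exact: block_suitable hk_pred].
- by split; [exact: suitable_block hT_pred | exact: block_suitable hT_pred].
Qed.
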